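(* If $T$ is a tree, then ${\rm mdim}(T)=\dim(M(T))=n_1(T)$, where $n_1(T)$ is the number of leaves (degree-one vertices) of $T$.
   Context: For a connected graph $H$, $d_H$ is the usual distance; for a vertex $v$ and an edge $e=ww'$, $d_H(e,v)=\min\{d_H(w,v),d_H(w',v)\}$. A set $S\subseteq V(H)$ is a resolving set if every two distinct vertices $x,y$ satisfy $d_H(x,v)\ne d_H(y,v)$ for some $v\in S$, and a mixed resolving set if the same holds for every two distinct elements of $V(H)\cup E(H)$; $\dim(H)$ and ${\rm mdim}(H)$ are the minimum cardinalities of a resolving set and of a mixed resolving set. The middle graph $M(G)$ is obtained from $G$ by subdividing each edge $e$ with a new vertex $v_e$, and then joining $v_e$ and $v_f$ whenever the edges $e,f$ of $G$ share an endvertex.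
   Formalization: The equality dim(M(T)) = n_1(T) is asserted only for trees T with other than two vertices, since M(K_2) is the path P_3 with dimension 1 while K_2 has two leaves; mdim(T) = n_1(T) is asserted for every finite tree. *)

(* Defs.v *)
From mathcomp Require Import all_boot.

Set Implicit Arguments.
Unset Strict Implicit.
Unset Printing Implicit Defensive.

Record sgraph := SGraph {
  vertex :> finType;
  adj : rel vertex;
  adj_sym : symmetric adj;
  adj_irrefl : irreflexive adj
}.
Arguments adj {s}.

Definition degree (G : sgraph) (v : G) : nat := #|[set w : G | adj v w]|.

Definition num_leaves (G : sgraph) : nat := #|[set v : G | degree v == 1]|.

Definition connected (G : sgraph) : Prop :=
  0 < #|G| /\ forall x y : G, connect adj x y.

(* [ucycle adj] also accepts the empty sequence and [:: x; y] for an edge xy;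
   the graph-theoretic cycles are those of size at least 3. *)
Definition acyclic (G : sgraph) : Prop :=
  forall c : seq G, ucycle adj c -> size c < 3.

Definition tree (G : sgraph) : Prop := connected G /\ acyclic G.

Definition edge_set (G : sgraph) : {set {set G}} :=
  [set A : {set G} | [exists x, exists y, adj x y && (A == [set x; y])]].

Definition edge (G : sgraph) : finType := {A : {set G} | A \in edge_set G}.

Definition ends (G : sgraph) (e : edge G) : {set G} := sval e.

Definition has_walk (G : sgraph) (x y : G) (n : nat) : bool :=
  [exists p : n.-tuple G, path adj x p && (last x p == y)].

(* The least length of a walk from x to y; it is less than #|G| when there is
   one, and the value is #|G| otherwise. *)
Definition dist (G : sgraph) (x y : G) : nat :=
  find (has_walk x y) (iota 0 #|G|).

(* [dist] is bounded by #|G|, so the initial value is neutral. *)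
Definition edge_dist (G : sgraph) (e : edge G) (v : G) : nat :=
  \big[minn/#|G|]_(w in ends e) dist w v.

Definition elt_dist (G : sgraph) (x : G + edge G) (v : G) : nat :=
  match x with
  | inl u => dist u v
  | inr e => edge_dist e v
  end.

Definition resolving (G : sgraph) (S : {set G}) : bool :=
  [forall x : G, forall y : G,
    (x != y) ==> [exists v in S, dist x v != dist y v]].

Definition mixed_resolving (G : sgraph) (S : {set G}) : bool :=
  [forall x : (G + edge G)%type, forall y : (G + edge G)%type,
    (x != y) ==> [exists v in S, elt_dist x v != elt_dist y v]].

(* The full vertex set is both resolving and mixed resolving in every graph,
   so both minima below are taken over nonempty families. *)
Definition dim (G : sgraph) : nat :=
  #|[arg min_(S < [set: G] | resolving S) #|S|]|.

Definition mdim (G : sgraph) : nat :=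
  #|[arg min_(S < [set: G] | mixed_resolving S) #|S|]|.

Definition middle_adj (G : sgraph) (x y : G + edge G) : bool :=
  match x, y with
  | inl _, inl _ => false
  | inl u, inr e => u \in ends e
  | inr e, inl u => u \in ends e
  | inr e, inr f => (e != f) && (ends e :&: ends f != set0)
  end.

Lemma middle_adj_sym (G : sgraph) : symmetric (@middle_adj G).
Proof. by move=> [u|e] [v|f] //=; rewrite eq_sym setIC. Qed.

Lemma middle_adj_irrefl (G : sgraph) : irreflexive (@middle_adj G).
Proof. by move=> [u|e] //=; rewrite eqxx. Qed.

Definition middle (G : sgraph) : sgraph :=
  SGraph (@middle_adj_sym G) (@middle_adj_irrefl G).

(* Main.v *)
(* In a tree, if b is an end of an element y but not of an element x, then among
   the vertices that b separates from x one farthest from b is a leaf l, and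
   d(y, l) <= d(b, l) < d(x, l); so the leaves resolve all the elements.
   Conversely only the leaf l tells its pendant edge from its support vertex.
   The distance in M(T) from an element x to a vertex v of T is d(x, v) + 1 unless
   x = v, so the leaves also resolve M(T).  For the lower bound there, let S resolve
   M(T), and let l be a leaf with pendant edge e and support vertex w.  In M(T)
   the pair (w, e) is resolved only by l, e, w, and two leaves at w are resolved
   only by themselves and their pendant edges.  Hence if S misses l and e, then it
   contains w, and it hits the corresponding pair of every other leaf at w: this
   yields an injection from the leaves to S. *)

Require Import Defs.
From mathcomp Require Import all_boot.

Set Implicit Arguments.
Unset Strict Implicit.
Unset Printing Implicit Defensive.

(** * Distances in an arbitrary graph *)

Section Distance.

Variable G : sgraph.
Implicit Types x y z u v w : G.

Lemma dist_le_card x y : dist x y <= #|G|.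
Proof. by rewrite /dist (leq_trans (find_size _ _)) ?size_iota. Qed.

Lemma dist_le_walk x p : path adj x p -> dist x (last x p) <= size p.
Proof.
move=> xp; have [lt_pG|] := ltnP (size p) #|G|; last first.
  exact/leq_trans/dist_le_card.
rewrite leqNgt; apply/negP => lt_pd.
have := before_find 0 lt_pd; rewrite nth_iota // add0n => /negbT/negP[].
by apply/existsP; exists (in_tuple p); rewrite xp eqxx.
Qed.

Lemma dist_walk x y : connect adj x y ->
  exists p, [/\ path adj x p, last x p = y & size p = dist x y].
Proof.
case/connectP=> p0 xp0 ->; case/shortenP: xp0 => p xp Up _.
(* A duplicate-free walk is short enough for [find] to succeed within [iota 0 #|G|]. *)
have lt_pG : size p < #|G|.
  by move/card_uniqP: Up => /= <-; apply: max_card.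
have lt_dG := leq_ltn_trans (dist_le_walk xp) lt_pG.
have := lt_dG; rewrite -[X in _ < X](size_iota 0) -has_find => /(nth_find 0).
rewrite nth_iota // add0n => /existsP[q /andP[xq /eqP q_y]].
by exists q; rewrite size_tuple.
Qed.

Lemma dist_step x y z : adj x y -> dist x z <= (dist y z).+1.
Proof.
move=> xy; have [yz|nyz] := boolP (connect adj y z).
  have [p [yp <- <-]] := dist_walk yz.
  by apply: (@dist_le_walk x (y :: p)); rewrite /= xy.
(* With [z] unreachable from [y], the search returns its default [#|G|], which bounds every
   distance. *)
suff -> : dist y z = #|G| by rewrite ltnW // ltnS dist_le_card.
apply/eqP; rewrite eqn_leq dist_le_card leqNgt; apply/negP=> lt_dG.
have := lt_dG; rewrite -[X in _ < X](size_iota 0) -has_find.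
case/hasP=> n _ /existsP[p /andP[yp /eqP p_z]].
by case/connectP: nyz; exists p.
Qed.

Lemma dist_sym_le x y : connect adj x y -> dist y x <= dist x y.
Proof.
move/dist_walk=> [p [xp <- <-]].
have rp : path adj (last x p) (rev (belast x p)).
  by rewrite rev_path (eq_path (e' := adj)) // => a b; rewrite adj_sym.
have := dist_le_walk rp; rewrite size_rev size_belast.
by case: p {xp rp} => [|y' p] //=; rewrite rev_cons last_rcons.
Qed.

Lemma dist0 x : dist x x = 0.
Proof. by apply/eqP; rewrite -leqn0; exact: (@dist_le_walk x [::]). Qed.

(** Descending along [F] gives a walk of length at most [F x]; as [F] drops by at most one per edge,
    no walk is shorter. *)
Lemma dist_eqF (F : G -> nat) v :
    F v = 0 -> (forall x y, adj x y -> F x <= (F y).+1) ->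
    (forall x, x != v -> exists2 y, adj x y & F y < F x) ->
  forall x, connect adj x v /\ dist x v = F x.
Proof.
move=> Fv0 F_step F_next x.
have [p [xp pv leF]] : exists p, [/\ path adj x p, last x p = v & size p <= F x].
  have [n] := ubnP (F x); elim: n x => // n IHn x.
  rewrite ltnS => leFn; have [->|nxv] := eqVneq x v; first by exists [::].
  have [y xy ltF] := F_next x nxv.
  have [p [yp pv lep]] := IHn y (leq_trans ltF leFn).
  by exists (y :: p); split=> //=; [rewrite xy | apply: leq_ltn_trans ltF].
have cxv : connect adj x v by apply/connectP; exists p.
split=> //; apply/eqP; rewrite eqn_leq; apply/andP; split.
  by rewrite -pv (leq_trans (dist_le_walk xp)).
have [q [xq q_v <-]] := dist_walk cxv.
elim: q x xq q_v {p xp pv leF cxv} => [|y q IHq] x /=; first by move=> _ ->; rewrite Fv0.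
by case/andP=> xy yq q_v; rewrite (leq_trans (F_step _ _ xy)) // ltnS IHq.
Qed.

End Distance.

(** * Distances in a connected graph *)

Section ConnectedDistance.

Variable G : sgraph.
Hypothesis connG : forall x y : G, connect adj x y.
Implicit Types x y z u v w : G.

Lemma dist_sym x y : dist x y = dist y x.
Proof. by apply/eqP; rewrite eqn_leq !dist_sym_le. Qed.

Lemma dist_eq0 x y : (dist x y == 0) = (x == y).
Proof.
apply/eqP/eqP => [|->]; last exact: dist0.
by have [[|z p] [_ <- <-]] := dist_walk (connG x y).
Qed.

Lemma dist_next x z : x != z -> exists2 y, adj x y & dist x z = (dist y z).+1.
Proof.
have [[|y p] [/= xp p_z sz]] := dist_walk (connG x z); first by rewrite p_z eqxx.
move=> _; case/andP: xp => xy yp; exists y => //; apply/eqP.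
by rewrite eqn_leq dist_step // -sz ltnS -p_z dist_le_walk.
Qed.

Lemma dist_triangle y x z : dist x z <= dist x y + dist y z.
Proof.
have [p [xp <- <-]] := dist_walk (connG x y).
elim: p x xp => //= w p IHp x /andP[xw wp].
by rewrite (leq_trans (dist_step _ xw)) // addSn ltnS IHp.
Qed.

Lemma dist_edge_le x y z : adj x y -> dist z x <= (dist z y).+1.
Proof. by move=> xy; rewrite !(dist_sym z) dist_step. Qed.

(* Every walk leaving a vertex of degree one passes through its neighbour. *)
Lemma dist_pendant x y z :
  (forall u, adj x u -> u = y) -> x != z -> dist x z = (dist y z).+1.
Proof. by move=> nbr /dist_next[u /nbr ->]. Qed.

End ConnectedDistance.

Lemma degree1P (G : sgraph) (x : G) :
  reflect (exists2 y, adj x y & forall u, adj x u -> u = y) (degree x == 1).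
Proof.
apply: (iffP cards1P) => [[y xE]|[y xy nbr]].
  have xyE u : adj x u = (u == y) by rewrite -in_set1 -xE inE.
  by exists y => [|u]; rewrite xyE // => /eqP.
by exists y; apply/setP=> u; rewrite !inE; apply/idP/eqP => [/nbr|->].
Qed.

(** * Separation and leaves in a tree *)

Section Tree.

Variable T : sgraph.
Hypothesis treeT : tree T.
Implicit Types x y z u v w b l : T.

Let connT x y : connect adj x y.
Proof. by case: treeT => -[]. Qed.

(* Otherwise the geodesics from [u] and [u'] to [z] avoid [v], and close up into
   a cycle through [v]. *)
Lemma tree_nbr_closer v u u' z : adj v u -> adj v u' ->
  dist u z <= dist v z -> dist u' z <= dist v z -> u = u'.
Proof.
(* Adjacency in the tree with [v] deleted. *)
pose r := [rel a b : T | [&& adj a b, a != v & b != v]].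
have r_sym : connect_sym r.
  by apply: sym_connect_sym => a b; rewrite /= adj_sym [(a != v) && _]andbC.
(* Along a geodesic from [w], all later vertices are nearer to [z] than [v] is, so the geodesic
   misses [v]. *)
have to_z n w : w != v -> dist w z = n -> n <= dist v z -> connect r w z.
  elim: n w => [|n IHn] w nwv wz le_nv.
    by move/eqP: wz; rewrite dist_eq0 // => /eqP->.
  have [w' ww'] : exists2 w', adj w w' & dist w z = (dist w' z).+1.
    by apply: dist_next; rewrite // -dist_eq0 // wz.
  rewrite wz => -[w'z].
  have nw'v : w' != v by apply: contraTneq le_nv => <-; rewrite -w'z ltnn.
  apply: connect_trans (IHn w' nw'v (esym w'z) (ltnW le_nv)).
  by apply: connect1; rewrite /= ww' nwv.
have nbr_neq w : adj v w -> w != v.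
  by move=> vw; apply: contraTneq vw => ->; rewrite adj_irrefl.
move=> vu vu' le_u le_u'; apply/eqP; apply: contraT => nuu'.
have : connect r u u'.
  apply: connect_trans (to_z _ u (nbr_neq u vu) erefl le_u) _.
  by rewrite r_sym; apply: to_z (nbr_neq u' vu') erefl le_u'.
case/connectP=> p0 up0 u'E; move: nuu' vu'; rewrite u'E.
case/shortenP: up0 => p up Up _ nuu' vu'.
have [_ /(_ (v :: u :: p))] := treeT.
(* As [u] and [u'] differ, [p] is nonempty and the cycle has at least three vertices. *)
case: p up Up nuu' vu' => [|w p] up Up nuu' vu'; first by rewrite eqxx in nuu'.
suff cyc : ucycle adj [:: v, u, w & p] by move/(_ cyc).
have up' : path adj u (w :: p) by apply: sub_path up => a b /andP[].
have nv_up : v \notin u :: w :: p.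
  rewrite inE negb_or eq_sym nbr_neq //=; apply/negP => v_wp.
  elim: (w :: p) (u) up v_wp => //= a q IHq b /andP[/and3P[_ _ nav] aq].
  by rewrite inE eq_sym (negPf nav) /=; apply: IHq aq.
apply/andP; split; last by rewrite cons_uniq nv_up.
suff: path adj v (rcons [:: u, w & p] v) by [].
by rewrite rcons_path; apply/andP; split; [apply/andP | rewrite adj_sym].
Qed.

(** Otherwise, for [u] other than [z], both [v] and the next vertex from [u] towards [z] are
    neighbours of [u] no farther from [z], hence equal, though the latter is strictly nearer. *)
Lemma tree_dist_adj u v z : adj u v -> dist u z != dist v z.
Proof.
move=> uv; apply/eqP=> uv_z; have [uz|nuz] := eqVneq u z.
  move: uv_z; rewrite uz dist0 => /esym/eqP; rewrite dist_eq0 // => /eqP vz.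
  by move: uv; rewrite uz vz adj_irrefl.
have [w uw uwz] := dist_next connT nuz.
have := @tree_nbr_closer u v w z uv uw; rewrite -uv_z leqnn uwz leqnSn.
move=> /(_ isT isT) vw; move: uwz; rewrite -vw -uv_z => /eqP.
by rewrite eqn_leq ltnn andbF.
Qed.

(** Only one neighbour of [v] can be no farther from [z] than [v], and [u] is already that one. *)
Lemma tree_dist_away v u u' z : adj v u -> adj v u' -> u != u' ->
  dist v z = (dist u z).+1 -> dist u' z = (dist v z).+1.
Proof.
move=> vu vu' nuu' v_z; apply/eqP; rewrite eqn_leq dist_step 1?adj_sym //=.
rewrite ltnNge; apply: contra nuu' => le_u'; apply/eqP.
by apply: tree_nbr_closer vu vu' _ le_u'; rewrite v_z.
Qed.

(* [z] and [z'] are not equidistant from [b] when adjacent, and the neighbour of [b]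
   towards the nearer one also leads to the farther one. *)
Lemma tree_gate b z z' : b != z -> b != z' -> (z == z') || adj z z' ->
  exists c, [/\ adj b c, dist b z = (dist c z).+1 & dist b z' = (dist c z').+1].
Proof.
wlog le_zz' : z z' / dist b z <= dist b z'.
  move=> gate nbz nbz' zz'; have [le|/ltnW le] := leqP (dist b z) (dist b z').
    exact: gate.
  have [|c [bc cz' cz]] := gate z' z le nbz' nbz; last by exists c.
  by rewrite eq_sym adj_sym.
move=> nbz nbz' /predU1P[<-|zz'].
  by have [c bc cz] := dist_next connT nbz; exists c.
have [c bc cz] := dist_next connT nbz; exists c; split=> //.
have lt_zz' : dist b z < dist b z'.
  by rewrite ltn_neqAle le_zz' !(dist_sym connT b) tree_dist_adj.
apply/eqP; rewrite eqn_leq dist_step //= (leq_trans _ lt_zz') // cz !ltnS.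
by apply: dist_edge_le; rewrite // adj_sym.
Qed.

(* The leaf is a vertex farthest from [b] among those that [b] separates from
   the given vertices. *)
Lemma tree_leaf_beyond b z z' : b != z -> b != z' -> (z == z') || adj z z' ->
  exists l, [/\ degree l == 1, dist l z = dist l b + dist b z
                             & dist l z' = dist l b + dist b z'].
Proof.
move=> nbz nbz' zz'.
pose U := [pred v | (dist v z == dist v b + dist b z) &&
                    (dist v z' == dist v b + dist b z')].
have Ub : U b by rewrite /= dist0 !eqxx.
case: (arg_maxnP (fun v => dist v b) Ub) => l /andP[/eqP lz /eqP lz'] l_max.
exists l; split=> //.
(* One neighbour [c] starts geodesics from [l] to [z], to [z'] and, unless [l = b], to [b]. *)
have [c [lc cz cz' cb]] : exists c, [/\ adj l c, dist l z = (dist c z).+1,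
    dist l z' = (dist c z').+1 & l != b -> dist l b = (dist c b).+1].
  have [->|nlb] := eqVneq l b.
    by have [c [bc cz cz']] := tree_gate nbz nbz' zz'; exists c.
  have [c lc cb] := dist_next connT nlb; exists c.
  have toward t : dist l t = dist l b + dist b t -> dist l t = (dist c t).+1.
    move=> lt; apply/eqP; rewrite eqn_leq dist_step //= lt cb addSn ltnS.
    exact: dist_triangle.
  by split=> //; apply: toward.
(* A second neighbour [u] leads away from [b], [z] and [z'], so it lies in [U] and is farther from
   [b] than [l]. *)
apply/degree1P; exists c => // u lu; apply/eqP; apply: contraT => nuc.
have ncu : c != u by rewrite eq_sym.
have ub : dist u b = (dist l b).+1.
  have [lb|nlb] := eqVneq l b; last exact: tree_dist_away lc lu ncu (cb nlb).
  apply/eqP; rewrite eqn_leq dist_step 1?adj_sym //= lb dist0 lt0n dist_eq0 //.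
  by apply: contraTneq lu => ->; rewrite lb adj_irrefl.
have Uu : U u.
  rewrite /= (tree_dist_away lc lu ncu cz) (tree_dist_away lc lu ncu cz').
  by rewrite ub lz lz' !addSn !eqxx.
by have /= := l_max u Uu; rewrite ub ltnn.
Qed.

End Tree.

(** * Vertices and edges as elements with ends *)

Section Elements.

Variable G : sgraph.
Implicit Types (x y : G + edge G) (u v w : G) (e f : edge G).

Lemma edgeP e : exists u v, adj u v /\ ends e = [set u; v].
Proof.
by case: e => A /= /[1!inE] /existsP[u /existsP[v /andP[uv /eqP->]]]; exists u, v.
Qed.

Lemma edge_with u v : adj u v -> exists e, ends e = [set u; v].
Proof.
move=> uv; have uvE : [set u; v] \in edge_set G.
  by rewrite inE; apply/existsP; exists u; apply/existsP; exists v; rewrite uv eqxx.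
by exists (exist (fun A : {set G} => A \in edge_set G) _ uvE).
Qed.

Lemma edge_at u e : u \in ends e -> exists2 v, adj u v & ends e = [set u; v].
Proof.
have [a [b [ab ->]]] := edgeP e; rewrite !inE => /orP[]/eqP->; first by exists b.
by exists a; rewrite 1?adj_sym // setUC.
Qed.

Definition elt_ends x : {set G} :=
  match x with inl u => [set u] | inr e => ends e end.

(** An edge has two distinct ends by irreflexivity, so its end set is never that of a vertex. *)
Lemma elt_ends_inj : injective elt_ends.
Proof.
have edge_n1 e u : ends e <> [set u].
  have [a [b [ab ->]]] := edgeP e => /setP abE.
  have := abE a; have := abE b; rewrite !inE !eqxx orbT => /esym/eqP bu /esym/eqP au.
  by move: ab; rewrite au bu adj_irrefl.
move=> [u|e] [v|f] /=.
- by move/set1_inj->.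
- by move/esym/edge_n1.
- by move/edge_n1.
- by move/val_inj->.
Qed.

Lemma elt_endsP x : exists u v, elt_ends x = [set u; v] /\ ((u == v) || adj u v).
Proof.
case: x => [u|e] /=; first by exists u, u; rewrite setUid eqxx.
by have [u [v [uv ->]]] := edgeP e; exists u, v; rewrite uv orbT.
Qed.

Lemma elt_dist_le x u v : u \in elt_ends x -> elt_dist x v <= dist u v.
Proof.
case: x => [w|e] /=; first by move/set1P->.
move=> ue; have := mem_index_enum u; rewrite /edge_dist.
elim: (index_enum _) => //= a s IHs; rewrite inE big_cons.
case/predU1P=> [<-|/IHs le_s]; first by rewrite ue geq_minl.
by case: ifP => // _; rewrite geq_min le_s orbT.
Qed.

Lemma elt_dist_attained x v : exists2 u, u \in elt_ends x & elt_dist x v = dist u v.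
Proof.
case: x => [w|e] /=; first by exists w; rewrite ?set11.
have [a [b [_ ab]]] := edgeP e; have ae : a \in ends e by rewrite ab set21.
have := @elt_dist_le (inr e) a v ae; rewrite /= /edge_dist.
elim/big_ind: _ => [le_G|m n IHm IHn|u ue _]; last by exists u.
  (* The initial value [#|G|] is attained too: here it is at most [dist a v], itself at most
     [#|G|]. *)
  by exists a => //; apply/eqP; rewrite eqn_leq le_G dist_le_card.
by rewrite /minn; case: ifP => _; [apply: IHm | apply: IHn].
Qed.

End Elements.

(** * The mixed metric dimension of a tree *)

Section TreeResolving.

Variable T : sgraph.
Hypothesis treeT : tree T.

Let connT (x y : T) : connect adj x y.
Proof. by case: treeT => -[]. Qed.

Definition leaves (G : sgraph) : {set G} := [set v : G | degree v == 1].

Lemma tree_leaves_resolve (x y : T + edge T) : x != y ->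
  exists2 l, l \in leaves T & elt_dist x l != elt_dist y l.
Proof.
(* Distinct elements have distinct end sets, so one has an end outside the other; the claim is
   symmetric. *)
wlog [b [yb nxb]] : x y / exists b, b \in elt_ends y /\ b \notin elt_ends x.
  move=> resolve nxy.
  have [yx|/subsetPn[b yb nxb]] := boolP (elt_ends y \subset elt_ends x).
    have : ~~ (elt_ends x \subset elt_ends y).
      apply: contra nxy => xy; apply/eqP/elt_ends_inj/eqP.
      by rewrite eqEsubset xy.
    case/subsetPn=> b xb nyb.
    have [||l lL nyx] := resolve y x; [by exists b | by rewrite eq_sym |].
    by exists l; rewrite 1?eq_sym.
  by apply: resolve nxy; exists b.
move=> _; have [z [z' [xE zz']]] := elt_endsP x.
move: nxb; rewrite xE !inE negb_or => /andP[nbz nbz'].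
have [l [degl lz lz']] := tree_leaf_beyond treeT nbz nbz' zz'.
exists l; first by rewrite inE.
have [u xu ->] := elt_dist_attained x l.
rewrite neq_ltn; apply/orP; right.
apply: leq_ltn_trans (elt_dist_le l yb) _.
rewrite !(dist_sym connT _ l).
move: xu; rewrite xE => /set2P[]->; rewrite ?lz ?lz' -[X in X < _]addn0;
  by rewrite ltn_add2l lt0n dist_eq0.
Qed.

Lemma leaves_mixed_resolving : mixed_resolving (leaves T).
Proof.
apply/forallP=> x; apply/forallP=> y; apply/implyP=> /tree_leaves_resolve[l lL ne].
by apply/existsP; exists l; rewrite lL.
Qed.

Lemma leaves_sub_mixed_resolving (S : {set T}) :
  mixed_resolving S -> leaves T \subset S.
Proof.
move=> resS; apply/subsetP=> l; rewrite inE => /degree1P[w lw nbr].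
have [e eE] := edge_with lw.
have := forallP resS (inl w) => /forallP/(_ (inr e))/existsP[v /andP[vS]].
(* Seen from any [v] other than [l], the support [w] is the nearer end of [e]. *)
suff : l != v -> elt_dist (inl w) v = elt_dist (inr e) v.
  by have [-> //|_ /(_ isT)->] := eqVneq l v; rewrite eqxx.
move=> nlv; have lv := dist_pendant connT nbr nlv.
have we : w \in elt_ends (inr e) by rewrite /= eE set22.
have [u ue uv] := elt_dist_attained (inr e) v.
apply/eqP; rewrite eqn_leq elt_dist_le // andbT uv.
by move: ue; rewrite /= eE => /set2P[]->; rewrite ?lv.
Qed.

Lemma mdim_tree : mdim T = num_leaves T.
Proof.
rewrite /mdim; case: arg_minnP => [|S resS minS].
  apply/forallP=> x; apply/forallP=> y; apply/implyP=> /tree_leaves_resolve[l _ ne].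
  by apply/existsP; exists l; rewrite inE.
apply/eqP; rewrite eqn_leq minS ?leaves_mixed_resolving //=.
exact/subset_leq_card/leaves_sub_mixed_resolving.
Qed.

End TreeResolving.

(** * The metric dimension of the middle graph *)

Section TreeMiddle.

Variable T : sgraph.
Hypothesis treeT : tree T.
Implicit Types (u v w l : T) (e f : edge T) (x y : middle T).

Let connT u v : connect adj u v.
Proof. by case: treeT => -[]. Qed.

Lemma elt_dist_step x y u v :
  u \in elt_ends x -> u \in elt_ends y -> elt_dist x v <= (elt_dist y v).+1.
Proof.
move=> xu yu; have [u' yu' ->] := elt_dist_attained y v.
apply: leq_trans (elt_dist_le v xu) _.
have [->//|nuu'] := eqVneq u u'; apply: dist_step.
have [a [b [yE ab]]] := elt_endsP y; move: yu yu' nuu'; rewrite yE.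
case/orP: ab => [/eqP<-|ab]; first by rewrite setUid => /set1P-> /set1P->; rewrite eqxx.
by move=> /set2P[]-> /set2P[]->; rewrite ?eqxx // adj_sym.
Qed.

(** A shortest walk runs through edge vertices and needs one extra step to reach [inl v], unless it
    starts there. *)
Lemma middle_connect_dist x v :
  connect adj x (inl v : middle T) /\
  dist x (inl v : middle T) = elt_dist x v + (x != inl v).
Proof.
apply: (dist_eqF (F := fun y : middle T => elt_dist y v + (y != inl v))) => {x}.
- by rewrite /= dist0 eqxx.
- have le1 (n : nat) (c : bool) : n + c <= n.+1 by rewrite -addn1 leq_add2l leq_b1.
  have step e x u : u \in elt_ends x -> u \in ends e ->
      elt_dist x v + (x != inl v) <= (elt_dist (inr e) v + 1).+1.
    move=> xu ue; apply: leq_trans (le1 _ _) _; rewrite ltnS addn1.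
    exact: (@elt_dist_step x (inr e) u v xu ue).
  move=> [u|e] [w|f] // adj_xy.
  + by apply: (step f (inl u) u) adj_xy; rewrite set11.
  + apply: leq_trans (le1 _ _) _; rewrite ltnS; apply: leq_trans (leq_addr _ _).
    exact: elt_dist_le.
  + case/andP: adj_xy => _ /set0Pn[u /setIP[ue uf]].
    exact: (step f (inr e) u).
move=> x nxv; have [u xu x_u] := elt_dist_attained x v.
(* From the end [u] of [x] nearest to [v], the next vertex is [v] itself or the edge leading from
   [u] towards [v]. *)
have [uv|nuv] := eqVneq u v.
  exists (inl v); last by rewrite /= dist0 eqxx nxv addn1.
  case: x nxv xu {x_u} => [w|e] /=; last by rewrite uv.
  by move=> nwv /set1P wu; rewrite -wu uv eqxx in nwv.
have [u' uu' u_v] := dist_next connT nuv.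
have [f fE] := edge_with uu'.
have lt_fx : elt_dist (inr f) v + 1 < elt_dist x v + 1.
  by rewrite ltn_add2r x_u u_v ltnS elt_dist_le //= fE set22.
exists (inr f); last by rewrite nxv.
have uf : u \in ends f by rewrite fE set21.
case: x xu lt_fx {nxv x_u} => [w|e] /=; first by move/set1P <-.
move=> ue lt_fe; apply/andP; split; last by apply/set0Pn; exists u; rewrite inE ue.
by apply: contraTneq lt_fe => ->; rewrite ltnn.
Qed.

Lemma middle_connected x y : connect adj x y.
Proof.
have [u [_ _]] := elt_endsP x.
apply: (connect_trans (proj1 (middle_connect_dist x u))).
rewrite (sym_connect_sym (@adj_sym _)).
exact: (proj1 (middle_connect_dist y u)).
Qed.

Lemma leaves_resolve_middle : resolving ((inl @: leaves T) : {set middle T}).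
Proof.
have mem_leaf l : degree l == 1 -> (inl l : middle T) \in inl @: leaves T.
  by move=> degl; apply: imset_f; rewrite inE.
have at_leaf x y l : x = inl l -> degree l == 1 -> x != y ->
    [exists v in (inl @: leaves T : {set middle T}), dist x v != dist y v].
  move=> -> degl ne; apply/existsP; exists (inl l); rewrite mem_leaf //=.
  by rewrite dist0 eq_sym dist_eq0 1?eq_sym //; exact: middle_connected.
apply/forallP=> x; apply/forallP=> y; apply/implyP=> ne.
have [l lL nd] := tree_leaves_resolve treeT ne.
have degl : degree l == 1 by rewrite inE in lL.
(* Distances to [inl l] are the mixed ones plus one, except at [inl l] itself, which distance zero
   tells apart. *)
have [xl|nxl] := eqVneq x (inl l); first exact: at_leaf xl degl ne.
have [yl|nyl] := eqVneq y (inl l).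
  rewrite eq_sym in ne; have /existsP[v /andP[vL d]] := at_leaf _ _ _ yl degl ne.
  by apply/existsP; exists v; rewrite vL eq_sym.
apply/existsP; exists (inl l); rewrite mem_leaf //=.
by rewrite !(proj2 (middle_connect_dist _ l)) nxl nyl eqn_add2r.
Qed.

Hypothesis cardT : #|T| <> 2.

(** If both were leaves, a third vertex [z] would give [dist l z = dist l' z + 1 = dist l z + 2]. *)
Lemma leaves_not_adj l l' : adj l l' -> degree l == 1 -> degree l' != 1.
Proof.
move=> ll' /degree1P[w lw nbr]; apply/negP => /degree1P[w' lw' nbr'].
have ?: w = l' by rewrite (nbr l'). have ?: w' = l by rewrite (nbr' l) 1?adj_sym.
subst w w'; apply: cardT.
have <- : #|[set l; l']| = 2.
  by rewrite cards2; case: eqVneq ll' => // ->; rewrite adj_irrefl.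
apply: eq_card => z; rewrite !inE; apply/esym; apply: contraT.
rewrite negb_or ![z == _]eq_sym => /andP[nlz nl'z].
have := dist_pendant connT nbr nlz.
rewrite (dist_pendant connT nbr' nl'z) => /eqP.
by rewrite -addn2 -[X in X == _]addn0 eqn_add2l.
Qed.

Section PendantEdge.

Variables (l w : T) (e : edge T).
Hypothesis eE : ends e = [set l; w].
Hypothesis nbr : forall u, adj l u -> u = w.

Lemma middle_pendant f : l \in ends f -> f = e.
Proof.
case/edge_at=> u /nbr-> fE; apply: val_inj.
by rewrite -[LHS]/(ends f) fE -eE.
Qed.

(** The only neighbour of [inl l] in the middle graph is its pendant edge [e]. *)
Lemma middle_dist_leaf x : x != inl l ->
  dist (inl l : middle T) x = (dist (inr e : middle T) x).+1.
Proof.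
rewrite eq_sym; apply: (dist_pendant middle_connected) => -[u|f] //=.
by move/middle_pendant->.
Qed.

(* In the middle graph [e] and [w] are twins apart from the neighbour [l] of [e]. *)
Lemma middle_dist_support x : x != inl l -> x != inl w -> x != inr e ->
  dist (inl w : middle T) x = dist (inr e : middle T) x.
Proof.
move=> nxl nxw nxe; apply/eqP; rewrite eqn_leq; apply/andP; split.
  rewrite eq_sym in nxe; have [m em ->] := dist_next middle_connected nxe.
  (* A step from [e] that does not go to [l] lands on [w] or on a neighbour of [w]. *)
  case: m em => [u|f] /=.
    rewrite eE => /set2P[]->; last exact: leqnSn.
    by rewrite middle_dist_leaf // leqW // (@dist_step (middle T)) //= eE set22.
  case/andP=> nef /set0Pn[u /setIP[]]; rewrite eE => /set2P[]-> => [lf|wf].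
    by rewrite (middle_pendant lf) eqxx in nef.
  exact: (@dist_step (middle T) (inl w) (inr f)).
rewrite eq_sym in nxw; have [[u|f] // wf ->] := dist_next middle_connected nxw.
have [->|nef] := eqVneq e f; first exact: leqnSn.
apply: (@dist_step (middle T) (inr e) (inr f)); rewrite /= nef /=.
by apply/set0Pn; exists w; rewrite inE eE set22.
Qed.

End PendantEdge.

Lemma middle_dist_twin_leaves l l' w e e' x :
    ends e = [set l; w] -> (forall u, adj l u -> u = w) ->
    ends e' = [set l'; w] -> (forall u, adj l' u -> u = w) ->
    x != inl l -> x != inr e -> x != inl l' -> x != inr e' ->
  dist (inl l : middle T) x = dist (inl l' : middle T) x.
Proof.
move=> eE nbr e'E nbr' nxl nxe nxl' nxe'.
rewrite (middle_dist_leaf eE nbr nxl) (middle_dist_leaf e'E nbr' nxl').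
congr _.+1; have [->|nxw] := eqVneq x (inl w).
  rewrite !(proj2 (middle_connect_dist _ w)) /=; congr (_ + _).
  have at_w f : w \in ends f -> edge_dist f w = 0.
    move=> wf; apply/eqP; rewrite -leqn0 -(dist0 w).
    exact: (@elt_dist_le T (inr f)).
  by rewrite !at_w // ?eE ?e'E set22.
by rewrite -(middle_dist_support eE nbr) // -(middle_dist_support e'E nbr').
Qed.

(* The graph of the injection from the leaves to a resolving set [S]. *)
Definition claims (S : {set middle T}) l (x : middle T) : bool :=
  match x with
  | inl u => (u == l) ||
      [&& adj l u, (inl l : middle T) \notin S
        & [forall f : edge T, (l \in ends f) ==> ((inr f : middle T) \notin S)]]
  | inr f => l \in ends f
  end.

(** The pair [w], [e] is resolved only by [l], [e] and [w], and [w] is claimed only when the other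
    two are missing from [S]. *)
Lemma claims_ex S l : resolving S -> degree l == 1 ->
  exists2 x, x \in S & claims S l x.
Proof.
move=> resS /degree1P[w lw nbr]; have [e eE] := edge_with lw.
have [lS|nlS] := boolP ((inl l : middle T) \in S).
  by exists (inl l); rewrite //= eqxx.
have [eS|neS] := boolP ((inr e : middle T) \in S).
  by exists (inr e); rewrite //= eE set21.
have := forallP resS (inl w) => /forallP/(_ (inr e))/existsP[x /andP[xS]].
have [xw _|nxw] := eqVneq x (inl w).
  exists x => //; rewrite xw /= lw nlS /= orbC; apply/orP; left.
  by apply/forallP=> f; apply/implyP=> /(middle_pendant eE nbr)->.
have nxl : x != inl l by apply: contraNneq nlS => <-.
have nxe : x != inr e by apply: contraNneq neS => <-.
by rewrite (middle_dist_support eE nbr nxl nxw nxe) eqxx.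
Qed.

(** As leaves are never adjacent, an edge has at most one leaf end and no leaf is claimed by
    another. Two leaves claiming the same support would form a pair that [S] does not resolve. *)
Lemma claims_inj S l l' x : resolving S -> degree l == 1 -> degree l' == 1 ->
  claims S l x -> claims S l' x -> l = l'.
Proof.
move=> resS degl degl'; case: x => [u|f] /=; last first.
  move=> lf l'f; apply/eqP; apply: contraT => nll'.
  have [v lv fE] := edge_at lf; move: l'f; rewrite fE.
  case/set2P=> l'E; first by rewrite l'E eqxx in nll'.
  by move: (leaves_not_adj lv degl); rewrite -l'E degl'.
case/predU1P=> [->|/and3P[lu nlS /forallP nS]].
  case/predU1P=> // /andP[l'l _].
  by have := leaves_not_adj l'l degl'; rewrite degl.
case/predU1P=> [ul'|/and3P[l'u nl'S /forallP nS']].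
  by have := leaves_not_adj lu degl; rewrite ul' degl'.
apply/eqP; apply: contraT => nll'.
have [e eE] := edge_with lu; have [e' e'E] := edge_with l'u.
have nbr_u (a b : T) : degree a == 1 -> adj a b -> forall c, adj a c -> c = b.
  by move=> /degree1P[w _ nbr] /nbr-> c /nbr.
have := forallP resS (inl l) => /forallP/(_ (inl l'))/implyP.
case/(_ nll')/existsP=> x /andP[xS].
have off y : y \notin S -> x != y by move=> nyS; apply: contraNneq nyS => <-.
have neS : (inr e : middle T) \notin S by have := nS e; rewrite eE set21.
have ne'S : (inr e' : middle T) \notin S by have := nS' e'; rewrite e'E set21.
have := middle_dist_twin_leaves eE (nbr_u l u degl lu) e'E (nbr_u l' u degl' l'u).
move=> /(_ x (off _ nlS) (off _ neS) (off _ nl'S) (off _ ne'S))->.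
by rewrite eqxx.
Qed.

Lemma card_leaves_le_resolving (S : {set middle T}) :
  resolving S -> #|leaves T| <= #|S|.
Proof.
move=> resS; pose g l := [pick x in S | claims S l x].
have gP l : l \in leaves T -> exists x, [/\ g l = Some x, x \in S & claims S l x].
  rewrite inE => /(claims_ex resS)[y yS lydx]; rewrite /g.
  by case: pickP => [x /andP[xS lx]|/(_ y)/andP[]//]; exists x.
have g_inj : {in leaves T &, injective g}.
  move=> l l' lL l'L; have [x [-> _ lx]] := gP l lL.
  have [x' [-> _ l'x']] := gP l' l'L => -[xx']; rewrite !inE in lL l'L.
  by apply: claims_inj resS lL l'L lx _; rewrite xx'.
(* Since [g] is option-valued, [S] is replaced by its image under [Some]. *)
rewrite -(card_in_imset g_inj) -(card_imset (mem S) (@Some_inj _)).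
apply/subset_leq_card/subsetP=> _ /imsetP[l lL ->].
by have [x [-> xS _]] := gP l lL; apply: imset_f.
Qed.

Lemma dim_middle_tree : dim (middle T) = num_leaves T.
Proof.
rewrite /dim; case: arg_minnP => [|S resS minS].
  apply/forallP=> x; apply/forallP=> y; apply/implyP=> ne.
  apply/existsP; exists y; rewrite inE dist0 dist_eq0 //.
  exact: middle_connected.
apply/eqP; rewrite eqn_leq card_leaves_le_resolving // andbT.
rewrite (leq_trans (minS _ leaves_resolve_middle)) //.
by rewrite card_imset //; exact: inl_inj.
Qed.

End TreeMiddle.

(* The middle graph of the one-edge tree is a path on three vertices, of metric
   dimension 1, while that tree has two leaves. *)
Theorem theorem4p2 (T : sgraph) (hT : tree T) :
  mdim T = num_leaves T /\ (#|T| <> 2 -> dim (middle T) = num_leaves T).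
Proof. by split; [apply: mdim_tree | apply: dim_middle_tree]. Qed.
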